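(* Let $m\ge 1$. For each integer $k$ with $m^2\le k\le 3m^2-4m+2$, there exists a matrix in $\Lambda_{2m}^m$ having a critical set of size $k$.
   Context: $\Lambda_{n}^{x}$ is the set of $n\times n$ $(0,1)$-matrices with every row sum and every column sum equal to $x$. A matrix $M$ is identified with the set of triples $\{(i,j,M_{ij})\}$. A subset $D\subseteq M$ is a defining set for $M$ if $M$ is the unique element of $\Lambda_{2m}^m$ containing $D$; a critical set is a defining set none of whose proper subsets is a defining set; its size is its number of triples. *)

(* Defs.v *)
From mathcomp Require Import all_boot all_order all_algebra.

Set Implicit Arguments.
Unset Strict Implicit.
Unset Printing Implicit Defensive.

(* A (0,1)-matrix is a boolean matrix: true is the entry 1, false the entry 0,
   and the sums below are taken in nat through the coercion bool >-> nat. *)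
Definition Lambda (n x : nat) : {set 'M[bool]_n} :=
  [set M : 'M[bool]_n | [forall i, \sum_(j < n) (M i j : nat) == x]
                     && [forall j, \sum_(i < n) (M i j : nat) == x]].

Definition triples (n : nat) (M : 'M[bool]_n) : {set 'I_n * 'I_n * bool} :=
  [set (i, j, M i j) | i : 'I_n, j : 'I_n].

Definition defining_set (m : nat) (M : 'M[bool]_(2 * m))
    (D : {set 'I_(2 * m) * 'I_(2 * m) * bool}) : Prop :=
  [/\ M \in Lambda (2 * m) m,
      D \subset triples M
    & forall M' : 'M[bool]_(2 * m),
        M' \in Lambda (2 * m) m -> D \subset triples M' -> M' = M].

Definition critical_set (m : nat) (M : 'M[bool]_(2 * m))
    (D : {set 'I_(2 * m) * 'I_(2 * m) * bool}) : Prop :=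
  defining_set M D /\
  forall D' : {set 'I_(2 * m) * 'I_(2 * m) * bool},
    D' \proper D -> ~ defining_set M D'.

(* Main.v *)
(* View a (0,1)-matrix as an orientation of the complete bipartite graph between
   rows and columns: a 1 at (i, j) is an arc from row i to column j, a 0 an arc
   from column j to row i.  Two matrices with the same line sums differ by a union
   of directed cycles, so D is a defining set iff its complement is acyclic, and
   D is critical iff that acyclic arc set is maximal.  Hence, given potentials p
   (rows) and q (columns), the set of backward arcs is always defining, and it is
   critical as soon as every backward arc closes a directed cycle with forward
   arcs.

   For a circulant matrix of order n = 2m with ones at the offsets j - i in a set s
   of size m with 0 in s and n - 1 not in s, the ordering r_0 c_0 r_1 c_1 ... is a
   directed Hamiltonian path, and the number of backward arcs is m + 2 (sum of s).
   Sums of (m-1)-subsets of {1, ..., 2m - 2} take all intermediate values, which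
   gives all k of the parity of m.  The other parity is reached from the same
   circulants by changing this number by one: by +1 when 1 is in s (moving c_0 to
   the end of the ordering), and by -1 otherwise (switching four entries and
   exchanging the last two vertices of the ordering). *)
Require Import Defs.
From mathcomp Require Import all_boot all_order all_algebra.
From mathcomp Require Import zify.
Import GRing.Theory Num.Theory.
Local Open Scope ring_scope.

Set Implicit Arguments.
Unset Strict Implicit.
Unset Printing Implicit Defensive.

(** * Line sums under changes of single entries, and switches *)

Lemma LambdaP (n x : nat) (M : 'M[bool]_n) :
  reflect ((forall i, \sum_(j < n) (M i j : nat) = x)%N
           /\ (forall j, \sum_(i < n) (M i j : nat) = x)%N)
          (M \in Lambda n x).
Proof.
rewrite inE; apply: (iffP andP) => -[H1 H2]; split.
- by move=> i; apply/eqP/(forallP H1).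
- by move=> j; apply/eqP/(forallP H2).
- by apply/forallP => i; apply/eqP.
- by apply/forallP => j; apply/eqP.
Qed.

Lemma mem_triples (n : nat) (M : 'M[bool]_n) i j b :
  ((i, j, b) \in triples M) = (b == M i j).
Proof.
apply/imset2P/eqP => [[i' j' _ _ [-> -> ->]] // | ->].
by exists i j.
Qed.

Definition set_entry {n : nat} (N : 'M[bool]_n) (i j : 'I_n) (b : bool) : 'M[bool]_n :=
  \matrix_(r, c) if (r == i) && (c == j) then b else N r c.

Lemma set_entryE n (N : 'M[bool]_n) i j b r c :
  set_entry N i j b r c = if (r == i) && (c == j) then b else N r c.
Proof. by rewrite mxE. Qed.

(** The old value of the entry is added on the left and the new one on the right, so that no
    truncated subtraction in [nat] occurs. *)
Lemma set_entry_row n (N : 'M[bool]_n) i j b r :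
  (\sum_c (set_entry N i j b r c : nat) + (r == i) * N i j
   = \sum_c (N r c : nat) + (r == i) * b)%N.
Proof.
rewrite (bigD1 j) // [in RHS](bigD1 j) //= set_entryE eqxx andbT.
rewrite (eq_bigr (fun c => N r c : nat)); last first.
  by move=> c /negPf ne; rewrite set_entryE ne andbF.
by case: eqP => [-> | _]; lia.
Qed.

Lemma trmx_set_entry n (N : 'M[bool]_n) i j b : (set_entry N i j b)^T = set_entry N^T j i b.
Proof. by apply/matrixP => r c; rewrite mxE !set_entryE mxE andbC. Qed.

Lemma clear_entry_row n (N : 'M[bool]_n) i j r : N i j ->
  (\sum_c (set_entry N i j false r c : nat) + (r == i) = \sum_c (N r c : nat))%N.
Proof. by move=> Nij; have := set_entry_row N i j false r; rewrite Nij muln1 muln0 addn0. Qed.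

Lemma fill_entry_row n (N : 'M[bool]_n) i j r : ~~ N i j ->
  (\sum_c (set_entry N i j true r c : nat) = \sum_c (N r c : nat) + (r == i))%N.
Proof.
by move=> /negPf Nij; have := set_entry_row N i j true r; rewrite Nij muln1 muln0 addn0.
Qed.

Lemma clear_entry_col n (N : 'M[bool]_n) i j c : N i j ->
  (\sum_r (set_entry N i j false r c : nat) + (c == j) = \sum_r (N r c : nat))%N.
Proof.
move=> Nij; have := @clear_entry_row _ N^T j i c; rewrite mxE => /(_ Nij).
rewrite -trmx_set_entry.
by under eq_bigr do rewrite mxE; under [in RHS]eq_bigr do rewrite mxE.
Qed.

Lemma fill_entry_col n (N : 'M[bool]_n) i j c : ~~ N i j ->
  (\sum_r (set_entry N i j true r c : nat) = \sum_r (N r c : nat) + (c == j))%N.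
Proof.
move=> Nij; have := @fill_entry_row _ N^T j i c; rewrite mxE => /(_ Nij).
rewrite -trmx_set_entry.
by under eq_bigr do rewrite mxE; under [in RHS]eq_bigr do rewrite mxE.
Qed.

(** The classical interchange on rows [a], [b] and columns [d], [c]. Both ones are cleared before
    the two zeros are filled. *)
Definition switch {n : nat} (M : 'M[bool]_n) (a b d c : 'I_n) : 'M[bool]_n :=
  set_entry (set_entry (set_entry (set_entry M a d false) b c false) a c true) b d true.

Lemma switch_Lambda n x (M : 'M[bool]_n) (a b d c : 'I_n) :
  M a d -> M b c -> ~~ M a c -> ~~ M b d -> M \in Lambda n x -> switch M a b d c \in Lambda n x.
Proof.
move=> Mad Mbc Mac Mbd /LambdaP[Mr Mc].
have ab : a != b by apply: contraTneq Mad => ->.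
have cd : c != d by apply: contraTneq Mbc => ->.
have e1 : set_entry M a d false b c by rewrite set_entryE eq_sym (negPf ab).
have e2 : ~~ set_entry (set_entry M a d false) b c false a c.
  by rewrite !set_entryE (negPf ab) (negPf cd) andbF.
have e3 : ~~ set_entry (set_entry (set_entry M a d false) b c false) a c true b d.
  by rewrite !set_entryE [b == a]eq_sym [d == c]eq_sym (negPf ab) (negPf cd) !andbF.
apply/LambdaP; split=> [r|k]; rewrite /switch.
  rewrite fill_entry_row // fill_entry_row // addnAC clear_entry_row //.
  by rewrite clear_entry_row // Mr.
rewrite fill_entry_col // fill_entry_col // clear_entry_col //.
by rewrite clear_entry_col // Mc.
Qed.

(** * Backward cells of an ordering, and when they form a critical set *)

Definition back_cells {n : nat} (M : 'M[bool]_n) (p q : 'I_n -> nat) : {set 'I_n * 'I_n} :=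
  [set c | M c.1 c.2 != (p c.1 < q c.2)%N].

Definition triples_on {n : nat} (M : 'M[bool]_n) (B : {set 'I_n * 'I_n}) :
    {set 'I_n * 'I_n * bool} :=
  [set (c.1, c.2, M c.1 c.2) | c in B].

Lemma card_triples_on n (M : 'M[bool]_n) B : #|triples_on M B| = #|B|.
Proof. by apply: card_imset => -[a b] [c d] [/= -> -> _]. Qed.

Section Ordering.

Context {n : nat} (M : 'M[bool]_n) (p q : 'I_n -> nat).

(** The sum of [A i j * (p i - q j)] depends only on the line sums of [A]. On forward cells [M] has
    a 1 exactly where this weight is negative, so each term of [M'] is at least that of [M]. Equal
    totals force equal terms, and no weight vanishes because [p i != q j]. *)
Lemma back_cells_unique (x : nat) (M' : 'M[bool]_n) :
  M \in Lambda n x -> M' \in Lambda n x ->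
  (forall i j, p i != q j) ->
  (forall i j, (i, j) \in back_cells M p q -> M' i j = M i j) -> M' = M.
Proof.
move=> /LambdaP[Mr Mc] /LambdaP[Mr' Mc'] pq agree.
pose f (A : 'M[bool]_n) i j : int := (A i j : nat)%:Z * ((p i)%:Z - (q j)%:Z).
have sumf A : A \in Lambda n x ->
    \sum_i \sum_j f A i j = x%:Z * (\sum_i (p i)%:Z) - x%:Z * (\sum_j (q j)%:Z).
  move=> /LambdaP[Ar Ac].
  transitivity (\sum_i \sum_j ((A i j : nat)%:Z * (p i)%:Z)
                - \sum_i \sum_j ((A i j : nat)%:Z * (q j)%:Z)).
    rewrite -sumrB; apply: eq_bigr => i _; rewrite -sumrB.
    by apply: eq_bigr => j _; rewrite /f mulrBr.
  rewrite [X in _ - X]exchange_big /= !mulr_sumr; congr (_ - _); apply: eq_bigr => i _.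
    rewrite -mulr_suml -(Ar i) -!natz natr_sum; congr (_ * _).
    by apply: eq_bigr => ? _; rewrite natz.
  rewrite -mulr_suml -(Ac i) -!natz natr_sum; congr (_ * _).
  by apply: eq_bigr => ? _; rewrite natz.
have M_L : M \in Lambda n x by apply/LambdaP.
have M'_L : M' \in Lambda n x by apply/LambdaP.
have pos i j : 0 <= f M' i j - f M i j.
  have := agree i j; rewrite inE /= /f; have := pq i j.
  by case: (ltngtP (p i) (q j)) => //; case: (M i j); case: (M' i j) => //= ? _;
    try (move=> /(_ isT) //); nia.
have zero : \sum_i \sum_j (f M' i j - f M i j) = 0.
  under eq_bigr do rewrite sumrB.
  by rewrite sumrB !sumf // subrr.
apply/matrixP => i j.
have z1 : \sum_j (f M' i j - f M i j) = 0.
  by apply: (psumr_eq0P _ zero) => // a _; apply: sumr_ge0.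
have z2 : f M' i j - f M i j = 0 by apply: (psumr_eq0P _ z1).
have := pq i j; move: z2; rewrite /f.
by case: (M i j); case: (M' i j) => //= ?; lia.
Qed.

(** These describe how a backward arc is closed to a cycle. For a 0, two forward arcs, row [i] to
    column [j'] to row [i'], lead to a row still before column [j]. For a 1, forward arcs lead from
    column [j] to row [i'] and from column [j'] to row [i], with row [i'] before column [j']. *)
Hypothesis escape0 : forall i j, (p i < q j)%N -> ~~ M i j ->
  exists i' j', [/\ (p i < q j')%N, (q j' < p i')%N, (p i' < q j)%N, M i j' & ~~ M i' j'].
Hypothesis escape1 : forall i j, (q j < p i)%N -> M i j ->
  exists i' j', [/\ (q j < p i')%N, (p i' < q j')%N, (q j' < p i)%N, ~~ M i' j & ~~ M i j'].

(* Reversing an alternating path of forward cells from row i to column j takes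
   one unit away from row i and from column j, and keeps all other sums. *)
Lemma flip_path i j : (p i < q j)%N ->
  exists N : 'M[bool]_n,
    [/\ forall r, (\sum_c (N r c : nat) + (r == i) = \sum_c (M r c : nat))%N,
        forall c, (\sum_r (N r c : nat) + (c == j) = \sum_r (M r c : nat))%N
      & forall r c, N r c != M r c ->
          [/\ (r, c) \notin back_cells M p q, (p i <= p r < q j)%N & (p i < q c <= q j)%N]].
Proof.
have [d] := ubnP (q j - p i); elim: d i => // d IH i le_d lt_ij.
case Mij: (M i j).
  exists (set_entry M i j false); split=> [r|c|r c].
  - exact: clear_entry_row.
  - exact: clear_entry_col.
  - rewrite set_entryE; case: andP => [[/eqP-> /eqP->] _|]; last by rewrite eqxx.
    by rewrite inE /= Mij lt_ij !leqnn; split.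
have [i' [j' [l1 l2 l3 Mij' Mi'j']]] := escape0 lt_ij (negbT Mij).
have [N0 [N0r N0c N0b]] := IH i' ltac:(lia) l3.
have l12 := ltn_trans l1 l2; have l23 := ltn_trans l2 l3.
(* The recursive path only touches rows at or after [i'] and columns after [i'], so it changes
   neither [(i, j')] nor [(i', j')]. *)
have e1 : N0 i j'.
  by apply: contraLR Mij' => /negPf N0ij'; apply/negP => Mij';
    have /N0b[_] : N0 i j' != M i j'; [rewrite N0ij' Mij' | rewrite leqNgt l12].
have e2 : ~~ N0 i' j'.
  by apply: contra Mi'j' => N0i'j'; apply: contraT => /negPf Mi'j';
    have /N0b[_ _] : N0 i' j' != M i' j'; [rewrite N0i'j' Mi'j' | rewrite ltnNge (ltnW l2)].
have ne : (i' == i) = false by apply/eqP => ei; rewrite ei ltnn in l12.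
have e3 : ~~ set_entry N0 i j' false i' j' by rewrite set_entryE ne.
exists (set_entry (set_entry N0 i j' false) i' j' true); split=> [r|c|r c].
- by rewrite fill_entry_row // addnAC clear_entry_row.
- by rewrite fill_entry_col // clear_entry_col.
- rewrite !set_entryE inE /=.
  case: andP => [[/eqP-> /eqP->] _|_].
    by rewrite (negPf Mi'j') ltnNge (ltnW l2) (ltnW l12) l3 l1 (ltnW l23).
  case: andP => [[/eqP-> /eqP->] _|_].
    by rewrite Mij' leqnn l1 lt_ij (ltnW l23).
  move=> /N0b[]; rewrite inE /= => -> /andP[h1 ->] /andP[h2 ->].
  by rewrite (leq_trans (ltnW l12) h1) (ltn_trans l12 h2).
Qed.

(** Reversing the cycle formed by the backward arc and a forward path changes [(i, j)] and no other
    backward cell, while all line sums are kept. *)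
Lemma back_cell_flip (x : nat) i j :
  M \in Lambda n x -> (forall i j, p i != q j) -> (i, j) \in back_cells M p q ->
  exists M' : 'M[bool]_n,
    [/\ M' \in Lambda n x, M' i j != M i j
      & forall r c, (r, c) \in back_cells M p q -> (r, c) != (i, j) -> M' r c = M r c].
Proof.
move=> /LambdaP[Mr Mc] pq back_ij.
have keep N : (forall r c, N r c != M r c -> (r, c) \notin back_cells M p q) ->
    forall r c, (r, c) \in back_cells M p q -> N r c = M r c.
  by move=> Nb r c back_rc; apply/eqP; apply: contraLR back_rc => /Nb.
have := back_ij; rewrite inE /=; case: ltngtP (pq i j) => // lt_ij _.
  rewrite eqb_id => Mij.
  (* For a backward 0, filling [(i, j)] gives back the unit that the reversed path takes from row
     [i] and column [j]. *)
  have [N [Nr Nc Nb]] := flip_path lt_ij.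
  have {}keep := keep N (fun r c ne => let: And3 h _ _ := Nb r c ne in h).
  have e1 : ~~ N i j by rewrite keep.
  exists (set_entry N i j true); split=> [||r c back_rc].
  - by apply/LambdaP; split=> [r|c]; rewrite (fill_entry_row, fill_entry_col) // (Nr, Nc) (Mr, Mc).
  - by rewrite set_entryE !eqxx (negPf Mij).
  - by rewrite xpair_eqE set_entryE => /negPf->; apply: keep.
rewrite eqbF_neg negbK => Mij.
have [i' [j' [l1 l2 l3 Mi'j Mij']]] := escape1 lt_ij Mij.
have [N [Nr Nc Nb]] := flip_path l2.
have {}keep := keep N (fun r c ne => let: And3 h _ _ := Nb r c ne in h).
have e1 : N i j by rewrite keep.
have l12 := ltn_trans l1 l2; have l23 := ltn_trans l2 l3.
have e2 : ~~ N i' j.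
  apply: contra Mi'j => Ni'j; apply: contraT => /negPf Mi'j.
  have /Nb[_ _] : N i' j != M i' j by rewrite Ni'j Mi'j.
  by rewrite ltnNge (ltnW l1).
have e3 : ~~ N i j'.
  apply: contra Mij' => Nij'; apply: contraT => /negPf Mij'.
  have /Nb[_] : N i j' != M i j' by rewrite Nij' Mij'.
  by rewrite [(p i < _)%N]ltnNge (ltnW l3) andbF.
have ne : (i' == i) = false by apply/eqP => ei; rewrite ei ltnn in l23.
have nj : (j' == j) = false by apply/eqP => ej; rewrite ej ltnn in l12.
(* For a backward 1, the cycle consists of the path from row [i'] to column [j'] and the three cells
   [(i, j)], [(i', j)], [(i, j')]. The two filled cells repay rows [i'], [i] and columns [j],
   [j']. *)
pose N1 := set_entry N i j false; pose N2 := set_entry N1 i' j true.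
have f1 : ~~ N1 i' j by rewrite set_entryE ne.
have f2 : ~~ N2 i j' by rewrite !set_entryE nj !andbF.
exists (set_entry N2 i j' true); split=> [||r c].
- apply/LambdaP; split=> [r|c].
    by rewrite fill_entry_row // fill_entry_row // addnAC clear_entry_row // Nr Mr.
  by rewrite fill_entry_col // fill_entry_col // clear_entry_col // Nc Mc.
- by rewrite !set_entryE !eqxx [j == _]eq_sym nj [i == _]eq_sym ne Mij.
- rewrite xpair_eqE => back_rc ne_rc; rewrite !set_entryE (negPf ne_rc).
  case: andP => [[/eqP er /eqP ec]|_].
    by move: back_rc; rewrite er ec inE /= (negPf Mij') ltnNge (ltnW l3).
  case: andP => [[/eqP er /eqP ec]|_]; last exact: keep.
  by move: back_rc; rewrite er ec inE /= (negPf Mi'j) ltnNge (ltnW l1).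
Qed.

End Ordering.

Lemma back_cells_critical (m : nat) (M : 'M[bool]_(2 * m)) (p q : 'I_(2 * m) -> nat) :
  M \in Lambda (2 * m) m -> (forall i j, p i != q j) ->
  (forall i j, (p i < q j)%N -> ~~ M i j ->
    exists i' j', [/\ (p i < q j')%N, (q j' < p i')%N, (p i' < q j)%N, M i j' & ~~ M i' j']) ->
  (forall i j, (q j < p i)%N -> M i j ->
    exists i' j', [/\ (q j < p i')%N, (p i' < q j')%N, (q j' < p i)%N, ~~ M i' j & ~~ M i j']) ->
  critical_set M (triples_on M (back_cells M p q)).
Proof.
move=> ML pq esc0 esc1; split.
  split=> //.
    by apply/subsetP => _ /imsetP[c _ ->]; rewrite mem_triples.
  move=> M' M'L /subsetP sub; apply: (back_cells_unique ML M'L pq) => i j back_ij.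
  have := sub (i, j, M i j); rewrite mem_triples => /(_ _)/eqP<- //.
  by apply/imsetP; exists (i, j).
(* A proper subset misses the triple of some backward cell, and flipping that cell yields a second
   completion. *)
move=> D' /properP[/subsetP sub [t /imsetP[[i j] back_ij ->] tD']] [_ _ uniqM].
have [M' [M'L ne agree]] := back_cell_flip esc0 esc1 ML pq back_ij.
move/negP: ne; apply; apply/eqP; congr (fun A : 'M_ _ => A i j).
apply: uniqM => //; apply/subsetP => t' t'D'.
have /imsetP[[r c] back_rc et] := sub _ t'D'.
rewrite et mem_triples /= eq_sym; apply/eqP/agree => //.
by apply: contraNneq tD' => -[<- <-]; rewrite -[(_, _, _)]et.
Qed.

(** * Circulant matrices: line sums and the number of backward cells *)

Lemma sum_ord_mem (n : nat) (s : seq nat) (F : nat -> nat) :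
  uniq s -> {in s, forall t, t < n}%N ->
  (\sum_(t < n) (nat_of_ord t \in s) * F t = \sum_(t <- s) F t)%N.
Proof.
move=> s_uniq s_lt; rewrite -(big_mkord xpredT (fun t => (t \in s) * F t)%N).
rewrite (eq_bigr (fun t => if t \in s then F t else 0%N)); last by move=> t _; case: ifP => _; lia.
rewrite -big_mkcond -big_filter; apply: perm_big; apply: uniq_perm => //.
  exact/filter_uniq/iota_uniq.
by move=> t; rewrite mem_filter mem_index_iota andb_idr // => /s_lt.
Qed.

Lemma sum_ord_le (n a : nat) : (a <= n)%N -> (\sum_(i < n) (a <= i) = n - a)%N.
Proof.
elim: n => [|n IH] le_an; first by rewrite big_ord0.
rewrite big_ord_recr /=; have [le|lt] := leqP a n; first by rewrite IH //; lia.
rewrite big1 => [|i _]; first by lia.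
by have := ltn_ord i; lia.
Qed.

Lemma add_mod_lt (n : nat) (i t : 'I_n) : ((if i + t < n then i + t else i + t - n) < n)%N.
Proof. by case: ifP; have := ltn_ord i; have := ltn_ord t; lia. Qed.

Lemma sub_mod_lt (n : nat) (j i : 'I_n) : ((if i <= j then j - i else j + n - i) < n)%N.
Proof. by case: ifP; have := ltn_ord i; have := ltn_ord j; lia. Qed.

Definition add_mod n (i t : 'I_n) : 'I_n := Ordinal (add_mod_lt i t).
Definition sub_mod n (j i : 'I_n) : 'I_n := Ordinal (sub_mod_lt j i).

Lemma add_modK n (i : 'I_n) : cancel (add_mod i) (fun j => sub_mod j i).
Proof.
move=> t; apply: val_inj => /=; have := ltn_ord i; have := ltn_ord t.
by case: (ltnP (i + t) n) => ?; case: ifP => ?; lia.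
Qed.

Lemma sub_modK n (j : 'I_n) : involutive (sub_mod j).
Proof.
move=> i; apply: val_inj => /=; have := ltn_ord i; have := ltn_ord j.
by case: (leqP i j) => ?; case: ifP => ?; lia.
Qed.

Definition circulant (n : nat) (s : seq nat) : 'M[bool]_n :=
  \matrix_(i, j) ((sub_mod j i : nat) \in s).

Lemma circulantE n s (i j : 'I_n) :
  circulant n s i j = ((if i <= j then j - i else j + n - i) \in s)%N.
Proof. by rewrite mxE. Qed.

Lemma circulant_Lambda (n : nat) (s : seq nat) :
  uniq s -> {in s, forall t, t < n}%N -> circulant n s \in Lambda n (size s).
Proof.
move=> s_uniq s_lt.
have sum1 : (\sum_(t < n) (nat_of_ord t \in s : nat) = size s)%N.
  rewrite -sum1_size -(sum_ord_mem (fun=> 1%N) s_uniq s_lt).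
  by apply: eq_bigr => t _; rewrite muln1.
apply/LambdaP; split=> [i|j].
  rewrite (reindex_inj (can_inj (add_modK i))) -[RHS]sum1 /=.
  by apply: eq_bigr => t _; rewrite mxE add_modK.
rewrite (reindex_inj (inv_inj (sub_modK j))) -[RHS]sum1 /=.
by apply: eq_bigr => t _; rewrite mxE sub_modK.
Qed.

(** The offset [t] lands below the diagonal exactly when it wraps around, which happens in the last
    [t] rows. Thus each [t] in [s] contributes [t] ones. *)
Lemma circulant_lower_sum (n : nat) (s : seq nat) :
  uniq s -> {in s, forall t, t < n}%N ->
  (\sum_(i < n) \sum_(j < n) (j < i) * circulant n s i j = sumn s)%N.
Proof.
move=> s_uniq s_lt.
transitivity (\sum_(i < n) \sum_(t < n) (nat_of_ord t \in s) * (n - t <= i))%N.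
  apply: eq_bigr => i _; rewrite (reindex_inj (can_inj (add_modK i))).
  apply: eq_bigr => t _; rewrite mxE add_modK mulnC; congr (_ * nat_of_bool _)%N.
  by have := ltn_ord i; have := ltn_ord t; rewrite /=; case: ifP; lia.
rewrite exchange_big /= sumnE -(sum_ord_mem id s_uniq s_lt).
apply: eq_bigr => t _; rewrite -big_distrr /= sum_ord_le ?leq_subr //.
by rewrite subKn // ltnW.
Qed.

Lemma card_back_cells (n : nat) (M : 'M[bool]_n) (p q : 'I_n -> nat) :
  (#|back_cells M p q| = \sum_i \sum_j (M i j != (p i < q j) : nat))%N.
Proof.
rewrite pair_big /= -sum1_card big_mkcond /=; apply: eq_bigr => c _.
by rewrite inE; case: (_ != _).
Qed.

(** Backward cells are the zeros on or above the diagonal and the ones below it. The count is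
    doubled and kept additive to avoid halves and subtraction. *)
Lemma card_circulant_back (n : nat) (s : seq nat) (p q : 'I_n -> nat) :
  uniq s -> {in s, forall t, t < n}%N -> (forall i j, (p i < q j) = (i <= j))%N ->
  (2 * #|back_cells (circulant n s) p q| + 2 * n * size s = n * n.+1 + 4 * sumn s)%N.
Proof.
move=> s_uniq s_lt pq; have /LambdaP[Mr _] := (circulant_Lambda s_uniq s_lt).
rewrite card_back_cells -(circulant_lower_sum s_uniq s_lt).
have tot : (\sum_(i < n) \sum_(j < n) (circulant n s i j : nat) = n * size s)%N.
  by under eq_bigr do rewrite Mr; rewrite sum_nat_const card_ord.
have tri : (2 * (\sum_(i < n) \sum_(j < n) (i <= j)) = n * n.+1)%N.
  rewrite (eq_bigr (fun i : 'I_n => n - i)%N) => [|i _]; last by rewrite sum_ord_le // ltnW.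
  have -> : (\sum_(i < n) (n - i) = \sum_(i < n) i.+1)%N.
    rewrite (reindex_inj rev_ord_inj); apply: eq_bigr => i _ /=.
    by have := ltn_ord i; lia.
  elim: (n) => [|k IH]; first by rewrite big_ord0.
  by rewrite big_ord_recr /= mulnDr IH; lia.
rewrite -mulnA -tot -tri -[4%N]/(2 * 2)%N -mulnA -!mulnDr; congr (2 * _)%N.
rewrite big_distrr -!big_split /=; apply: eq_bigr => i _.
rewrite big_distrr -!big_split /=; apply: eq_bigr => j _.
by rewrite pq; case: leqP; case: (circulant n s i j).
Qed.

Lemma circulant_offset n s (i j : 'I_n) x :
  (x < n)%N -> (i + x = j \/ i + x = j + n)%N -> circulant n s i j = (x \in s).
Proof.
move=> x_lt ijx; rewrite circulantE; congr (_ \in s).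
by have := ltn_ord i; have := ltn_ord j; case: (leqP i j) => ?; lia.
Qed.

Lemma circulant_diag n s (i : 'I_n) : (0 \in s)%N -> circulant n s i i.
Proof.
move=> s0; rewrite (@circulant_offset _ _ _ _ 0) ?addn0 //; last by left.
exact: leq_ltn_trans (leq0n i) (ltn_ord i).
Qed.

Lemma circulant_subdiag n s (i j : 'I_n) :
  {in s, forall t, t < n.-1}%N -> i = j.+1 :> nat -> ~~ circulant n s i j.
Proof.
move=> s_lt ij; rewrite circulantE ij ltnn; apply/negP => /s_lt.
by have := ltn_ord i; lia.
Qed.

(** * Critical sets from circulants and their two modifications *)

Definition has_critical_set (m k : nat) : Prop :=
  exists M : 'M[bool]_(2 * m)%N,
    M \in Lambda (2 * m) m /\
    exists D : {set 'I_(2 * m)%N * 'I_(2 * m)%N * bool}, critical_set M D /\ #|D| = k.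

Section Circulant.

Variables (m : nat) (s : seq nat).
Hypotheses (m_gt0 : (0 < m)%N) (s_uniq : uniq s) (s_size : size s = m).
Hypotheses (s_lt : {in s, forall t, t < (2 * m).-1}%N) (s0 : 0%N \in s).

Local Notation n := (2 * m)%N.
Let M := circulant n s.
Let p0 (i : 'I_n) := (2 * i)%N.
Let q0 (j : 'I_n) := (2 * j).+1.

Let s_ltn : {in s, forall t, t < n}%N.
Proof. by move=> t /s_lt; lia. Qed.

Let M_Lambda : M \in Lambda n m.
Proof. by have := circulant_Lambda s_uniq s_ltn; rewrite s_size. Qed.

Let p0q0 i j : (p0 i < q0 j)%N = (i <= j)%N.
Proof. by rewrite /p0 /q0; lia. Qed.

Let card_back0 : #|back_cells M p0 q0| = (m + 2 * sumn s)%N.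
Proof.
have := card_circulant_back s_uniq s_ltn p0q0.
by rewrite s_size -/M; move: #|_| => b; nia.
Qed.

(** Diagonal ones lead from row [i] to column [i], and subdiagonal zeros from column [j] to row
    [j + 1]. Both escapes follow this Hamiltonian path. *)
Lemma circulant_critical : has_critical_set m (m + 2 * sumn s).
Proof.
exists M; split=> //; exists (triples_on M (back_cells M p0 q0)); split; last first.
  by rewrite card_triples_on.
apply: back_cells_critical => // [i j | i j lt_ij Mij | i j lt_ji Mij].
- by rewrite /p0 /q0; lia.
- have ne : i != j by apply: contraNneq Mij => ->; apply: circulant_diag.
  have i'P : (i.+1 < n)%N by move: lt_ij ne (ltn_ord j); rewrite p0q0 -val_eqE /=; lia.
  exists (Ordinal i'P), i; split; try exact: circulant_diag; try exact: circulant_subdiag;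
  by move: lt_ij ne; rewrite p0q0 -val_eqE /p0 /q0 /=; lia.
- have ne : i != j.+1 :> nat.
    by apply: contraTneq Mij => ij; apply: circulant_subdiag.
  have lt_ji' : (j.+1 < i)%N by move: lt_ji ne; rewrite /p0 /q0; lia.
  have i'P : (j.+1 < n)%N by move: (ltn_ord i); lia.
  have j'P : (i.-1 < n)%N by move: (ltn_ord i); lia.
  exists (Ordinal i'P), (Ordinal j'P); split; try exact: circulant_subdiag;
    try by move: lt_ji'; rewrite /p0 /q0 /=; lia.
  by apply: circulant_subdiag => //=; lia.
Qed.

(* Moving column 0 behind all other vertices is possible when the offset 1 is
   present: then rows 0 and 1 share the first level of the ordering, and columns
   n-1 and 0 the last one. *)
Lemma circulant_critical_succ : (1 \in s)%N -> has_critical_set m (m + 2 * sumn s).+1.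
Proof.
move=> s1; pose q1 (j : 'I_n) := (if j == 0 :> nat then (2 * n).+1 else q0 j)%N.
have n_gt1 : (1 < n)%N by lia.
have Mlast (i j : 'I_n) : i = n.-1 :> nat -> j = 0 :> nat -> M i j.
  rewrite circulantE => -> ->; case: leqP => [|_]; first by lia.
  by have -> : (0 + n - n.-1 = 1)%N by lia.
have M01 (i j : 'I_n) : i = 0 :> nat -> j = 1 :> nat -> M i j.
  by rewrite circulantE => -> ->.
exists M; split=> //; exists (triples_on M (back_cells M p0 q1)); split; last first.
  rewrite card_triples_on -card_back0 !card_back_cells.
  rewrite exchange_big [in RHS]exchange_big /=.
  pose o : 'I_n := Ordinal (ltnW n_gt1).
  rewrite (bigD1 o) // [in RHS](bigD1 o) //= -addSn; congr (_ + _)%N; last first.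
    apply: eq_bigr => j; rewrite -val_eqE /= => ne.
    by apply: eq_bigr => i _; rewrite /q1 (negPf ne).
  (* Only column 0 changes its count. Placed last, its backward cells are its [m] zeros; before,
     they were its [m - 1] ones off the diagonal. *)
  have /LambdaP[_ /(_ o) Mo] := M_Lambda.
  have -> : (\sum_i (M i o != (p0 i < q1 o)) = m)%N.
    suff : (\sum_i (M i o != (p0 i < q1 o)) + \sum_i (M i o : nat) = n)%N by rewrite Mo; lia.
    rewrite -big_split (eq_bigr (fun=> 1%N)) => [|i _] /=; first by rewrite sum1_card card_ord.
    have -> : (p0 i < q1 o)%N by rewrite /p0 /q1 /=; have := ltn_ord i; lia.
    by case: (M i o).
  apply: (etrans (esym Mo)); rewrite (bigD1 o) //= [in RHS](bigD1 o) //= circulant_diag //.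
  rewrite p0q0 leqnn add0n add1n; congr _.+1; apply: eq_bigr => i; rewrite -val_eqE /= => ne.
  by rewrite p0q0 leqn0 (negPf ne); case: (M i o).
apply: back_cells_critical => // [i j | i j lt_ij Mij | i j lt_ji Mij].
- by rewrite /p0 /q1 /q0; case: ifP; lia.
- case: (eqVneq (j : nat) 0%N) => [j0 | j_neq0].
    have ne : (i : nat) != n.-1 by apply: contraNneq Mij => il; apply: Mlast.
    have ne0 : (i : nat) != 0%N.
      apply: contraNneq Mij => i0; have -> : i = j by apply: val_inj; rewrite /= i0 j0.
      exact: circulant_diag.
    have i'P : (i.+1 < n)%N by move: ne (ltn_ord i); lia.
    exists (Ordinal i'P), i; split; try exact: circulant_diag; try exact: circulant_subdiag;
    by rewrite /p0 /q1 /q0 ?j0 ?(negPf ne0) /=; have := ltn_ord i; lia.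
  have {}lt_ij : (i <= j)%N by move: lt_ij; rewrite /q1 (negPf j_neq0) p0q0.
  have ne : (i : nat) != j.
    by apply: contraNneq Mij => /val_inj ->; apply: circulant_diag.
  (* The diagonal arc from row 0 now goes to the end of the ordering, so the path leaves row 0
     through column 1, which the offset 1 provides, and continues to row 2. *)
  case: (eqVneq (i : nat) 0%N) => [i0 | i_neq0].
    have ne1 : (j : nat) != 1%N by apply: contraNneq Mij => j1; apply: M01.
    have i'P : (2 < n)%N by move: (ltn_ord j); lia.
    exists (Ordinal i'P), (Ordinal n_gt1).
    split; try exact: M01; try exact: circulant_subdiag;
    by rewrite /p0 /q1 /q0 ?(negPf j_neq0) /=; lia.
  have i'P : (i.+1 < n)%N by move: ne (ltn_ord j); lia.
  exists (Ordinal i'P), i; split; try exact: circulant_diag; try exact: circulant_subdiag;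
  by rewrite /p0 /q1 /q0 ?(negPf j_neq0) ?(negPf i_neq0) /=; lia.
- have j_neq0 : (j : nat) != 0%N.
    apply: contraTneq lt_ji => j0; rewrite /q1 j0 /p0 /=.
    by have := ltn_ord i; lia.
  have ne : i != j.+1 :> nat.
    by apply: contraTneq Mij => ij; apply: circulant_subdiag.
  have lt_ji' : (j.+1 < i)%N by move: lt_ji ne; rewrite /p0 /q1 (negPf j_neq0) /q0; lia.
  have i'P : (j.+1 < n)%N by move: (ltn_ord i); lia.
  have j'P : (i.-1 < n)%N by move: (ltn_ord i); lia.
  have ne0 : (i.-1 == 0)%N = false by lia.
  exists (Ordinal i'P), (Ordinal j'P); split.
  - by rewrite /p0 /q1 (negPf j_neq0) /q0 /=; lia.
  - by rewrite /p0 /q1 /= ne0 /q0 /=; lia.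
  - by rewrite /p0 /q1 /= ne0 /q0 /=; lia.
  - by apply: circulant_subdiag.
  - by apply: circulant_subdiag => //=; lia.
Qed.

(* When the offset 1 is absent, take t >= 2 minimal in s and switch the entries
   of rows n-1, n-2 in columns n-1, t-2; the new matrix allows the ordering in
   which row n-1 is moved behind column n-1. *)
Lemma circulant_critical_pred : (1 < m)%N -> (1 \notin s)%N ->
  has_critical_set m (m + 2 * sumn s).-1.
Proof.
move=> m_gt1 s1.
(* As [t] is the least positive element of [s] and is not 1, the offset [t - 1] is positive and
   absent. *)
have [t [ts t_gt1 t1]] : exists t, [/\ t \in s, (1 < t)%N & t.-1 \notin s].
  have ex : exists t, (0 < t)%N && (t \in s).
    have /hasP[t ts t_gt0] : has (fun t => 0 < t)%N s.
      apply: contraT => /hasPn s_0; have /(uniq_leq_size s_uniq) : {subset s <= [:: 0%N]}.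
        by move=> t /s_0; rewrite inE; case: t.
      by rewrite s_size leqNgt m_gt1.
    by exists t; rewrite t_gt0.
  case: (ex_minnP ex) => t /andP[t_gt0 ts] t_min; exists t; split=> //.
    by rewrite ltn_neqAle t_gt0 andbT; apply: contraNneq s1 => ->.
  apply/negP => t1s; have t1_gt0 : (0 < t.-1)%N.
    by rewrite lt0n; apply: contraNneq s1 => t10; rewrite (_ : 1%N = t) // -(prednK t_gt0) t10.
  by have := t_min t.-1; rewrite t1_gt0 t1s => /(_ isT); rewrite leqNgt prednK ?leqnn.
have t_lt := s_lt ts.
have e1 : (n.-2 + t = t - 2 + n)%N by lia.
have e2 : (n.-1 + t.-1 = t - 2 + n)%N by lia.
have e3 : (n.-2 + 1 = n.-1)%N by lia.
have t_ltn : (t < n)%N by lia.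
have t1_ltn : (t.-1 < n)%N by lia.
have n_gt1 : (1 < n)%N by lia.
have aP : (n.-1 < n)%N by lia.
have bP : (n.-2 < n)%N by lia.
have cP : (t - 2 < n)%N by lia.
have c_lt : (t - 2 < n.-2)%N by lia.
have ab_neq : (n.-1 == n.-2) = false by lia.
pose a : 'I_n := Ordinal aP; pose b : 'I_n := Ordinal bP; pose c : 'I_n := Ordinal cP.
have Maa : M a a by apply: circulant_diag.
(* The corners of the switch have offsets 0 and [t] (ones) and [t - 1] and 1 (zeros). *)
have Mbc : M b c by rewrite (@circulant_offset _ _ _ _ t) //; right.
have Mac : ~~ M a c by rewrite (@circulant_offset _ _ _ _ t.-1) //; right.
have Mba : ~~ M b a by rewrite (@circulant_offset _ _ _ _ 1) //; left.
have ac_le : (n.-1 <= t - 2)%N = false by clear -c_lt; lia.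
have ba_le : (b <= a)%N by apply: leq_pred.
have bc_le : (b <= c)%N = false by rewrite leqNgt c_lt.
have eqa (i : 'I_n) : (i == a) = (i == n.-1 :> nat) by [].
have eqb (i : 'I_n) : (i == b) = (i == n.-2 :> nat) by [].
have eqc (i : 'I_n) : (i == c) = (i == t - 2 :> nat)%N by [].
have ba : (b == a) = false by rewrite eqa eq_sym.
have ca : (c == a) = false by apply/eqP => -[]; clear -c_lt; lia.
have cb : (c == b) = false by apply/eqP => -[]; clear -c_lt; lia.
pose M' := switch M a b a c.
have M'E (i j : 'I_n) : M' i j =
   if (i == b) && (j == a) || (i == a) && (j == c) then true else
   if (i == b) && (j == c) || (i == a) && (j == a) then false else M i j.
  by rewrite /M' /switch !set_entryE; do 4 (case: (_ && _)).
pose p1 (i : 'I_n) := (if i == n.-1 :> nat then 2 * n else p0 i)%N.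
have p1q0 i j : (p1 i < q0 j)%N = (i <= j)%N && (i != a).
  rewrite /p1 eqa; case: eqP => _; last by rewrite p0q0 andbT.
  by rewrite andbF /q0; have := ltn_ord j; clear; lia.
exists M'; split; first exact: switch_Lambda.
exists (triples_on M' (back_cells M' p1 q0)); split; last first.
  rewrite card_triples_on -card_back0.
  (* The switch makes [(b, a)] and [(b, c)] forward and [(a, c)] backward. The cell [(a, a)] stays
     forward, as its entry and its direction both change. The net effect is -1. *)
  have -> : back_cells M' p1 q0 =
      (a, c) |: (back_cells M p0 q0 :\ (b, a) :\ (b, c)).
    apply/setP => -[i j]; rewrite !inE !xpair_eqE /= M'E p0q0 p1q0.
    case: (eqVneq i a) => [-> | i_a] /=.
      rewrite [a == b]eq_sym ba andbF; case: (eqVneq j c) => [->|j_c] //=.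
      case: (eqVneq j a) => [->|j_a] /=; first by rewrite Maa leqnn.
      congr (_ != _); move: j_a; rewrite eqa; have := ltn_ord j; clear; lia.
    rewrite andbT !orbF; case: (eqVneq i b) => [->|i_b] //=.
    case: (eqVneq j a) => [->|j_a] /=; first by rewrite ba_le andbF.
    case: (eqVneq j c) => [->|j_c] //=; rewrite bc_le //.
  rewrite cardsU1 !inE !xpair_eqE [a == b]eq_sym ba /= (negPf Mac) p0q0 /=.
  rewrite (cardsD1 (b, a) (back_cells M p0 q0)) (cardsD1 (b, c) (_ :\ _)).
  rewrite !inE /= (negPf Mba) Mbc !p0q0 !xpair_eqE eqxx ca ba_le bc_le.
  by rewrite ac_le.
have diag (i : 'I_n) : i != n.-1 :> nat -> M' i i.
  rewrite -eqa M'E => /negPf->; rewrite !andbF /=.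
  case: (eqVneq i b) => [->|_] /=; first by rewrite [b == c]eq_sym cb; apply: circulant_diag.
  exact: circulant_diag.
have subdiag (i j : 'I_n) : i = j.+1 :> nat -> ~~ M' i j.
  move=> ij; rewrite M'E.
  have -> : (i == b) && (j == a) || (i == a) && (j == c) = false.
    by rewrite !eqa eqb eqc ij; clear -c_lt; lia.
  by case: ifP => // _; apply: circulant_subdiag.
apply: back_cells_critical => // [| i j | i j lt_ij Mij | i j lt_ji Mij].
- exact: switch_Lambda.
- by rewrite /p1 /p0 /q0; case: ifP => _; clear; lia.
- move: lt_ij; rewrite p1q0 eqa => /andP[le_ij ne_i].
  have ne : i != j by apply: contraNneq Mij => <-; apply: diag.
  (* Row [n - 2] has no backward 0: only column [n - 1] could hold it, and the switch put a 1 there.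
     Hence row [i + 1] is not the moved row. *)
  have ne_i2 : i != n.-2 :> nat.
    apply: contraNneq Mij => i2; rewrite M'E eqb eqa i2 eqxx /= (_ : _ == _) //.
    by move: le_ij ne; rewrite -val_eqE /= i2; have := ltn_ord j; clear; lia.
  have i'P : (i.+1 < n)%N by move: ne_i (ltn_ord i); clear; lia.
  have ne' : (i.+1 == n.-1) = false by move: ne_i2 i'P; clear; lia.
  exists (Ordinal i'P), i; split; try exact: diag; try exact: subdiag;
    by move: le_ij ne; rewrite -val_eqE /p1 /p0 /q0 /= ?(negPf ne_i) ?ne'; clear; lia.
- have ne : i != j.+1 :> nat by apply: contraTneq Mij => ij; apply: subdiag.
  (* The moved row is entered from column [n - 2], through a subdiagonal zero. Column [n - 1] does
     not occur as [j], since the switch put a 0 at [(a, a)]. *)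
  case: (eqVneq (i : nat) n.-1) => [il | ne_i].
    have ne_j : j != n.-1 :> nat.
      apply: contraTneq Mij => jl; rewrite M'E !eqa eqb eqc il jl eqxx ab_neq /=.
      by rewrite ifN // gtn_eqF // (ltn_trans c_lt) // ltn_predL -ltnS (ltn_predK n_gt1).
    have i'P : (j.+1 < n)%N by move: ne_j (ltn_ord j); clear; lia.
    have i'b : (j.+1 <= n.-2)%N by move: i'P ne; rewrite il; clear; lia.
    have ne' : (j.+1 == n.-1) = false by move: i'b n_gt1; clear; lia.
    exists (Ordinal i'P), b; split; try exact: subdiag.
    - by rewrite /p1 /p0 /q0 /= ne'; clear; lia.
    - by rewrite p1q0 eqa /= ne' i'b.
    - by rewrite /p1 /q0 il eqxx /=; clear -n_gt1; lia.
    - by apply: subdiag; rewrite il /=; clear -n_gt1; lia.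
  have lt_ji' : (j.+1 < i)%N.
    by move: lt_ji ne; rewrite /p1 (negPf ne_i) /p0 /q0; clear; lia.
  have i'P : (j.+1 < n)%N by apply: ltn_trans lt_ji' (ltn_ord i).
  have j'P : (i.-1 < n)%N by apply: leq_ltn_trans (leq_pred i) (ltn_ord i).
  have ne' : (j.+1 == n.-1) = false by move: (ltn_ord i) lt_ji'; clear; lia.
  exists (Ordinal i'P), (Ordinal j'P); split.
  - by rewrite /p1 /q0 /p0 /= ne'; clear; lia.
  - by rewrite /p1 /q0 /p0 /= ne'; clear -lt_ji'; lia.
  - by rewrite /p1 /q0 /p0 /= (negPf ne_i); clear -lt_ji'; lia.
  - by apply: subdiag.
  - by apply: subdiag => /=; clear -lt_ji'; lia.
Qed.

End Circulant.

(** * Subset sums, and the realisation of every size *)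

Lemma double_bin2 (r : nat) : (2 * 'C(r, 2) + r = r * r)%N.
Proof. by elim: r => // r IH; rewrite binS bin1; nia. Qed.

(** The bounds are the sums of the [r] smallest and the [r] largest elements below [N]. In the
    induction the top element is used only when the sum cannot be reached without it. *)
Lemma subset_sum (N r v : nat) :
  (r <= N)%N -> ('C(r, 2) <= v)%N -> (v + 'C(r.+1, 2) <= r * N)%N ->
  exists s, [/\ uniq s, {in s, forall t, t < N}%N, size s = r & sumn s = v].
Proof.
elim: N r v => [|N IH] [|r] v //=; try by move=> *; exists nil; split=> //=; lia.
rewrite ltnS => le_rN lo hi.
have [le|gt] := leqP (v + 'C(r.+2, 2)) (r.+1 * N).
  have le_rN' : (r.+1 <= N)%N.
    rewrite ltn_neqAle le_rN andbT; apply: contraTneq le => <-; rewrite -ltnNge.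
    by rewrite binS bin1; have := double_bin2 r.+1; move: lo; clear; nia.
  have [s [s_uniq s_lt <- <-]] := IH r.+1 v le_rN' lo le.
  by exists s; split=> // t /s_lt /ltnW.
rewrite !(binS _ 1) !bin1 in lo hi gt.
have dbl := double_bin2 r.
(* What remains after using [N] must still reach the minimum for [r] elements. For [r < N] this
   follows from the failure of the other case; for [r = N] it is the lower bound [lo]. *)
have le_Nv : ('C(r, 2) + N <= v)%N.
  case: (ltnP r N) => [lt_rN | le_Nr]; last by clear -lo le_Nr; lia.
  have : (r * r.+1 <= r * N)%N by rewrite leq_mul2l lt_rN orbT.
  by clear -gt dbl; nia.
have [||s [s_uniq s_lt s_size s_sum]] := IH r (v - N)%N le_rN.
- by clear -le_Nv; lia.
- by rewrite binS bin1; clear -hi le_Nv; nia.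
exists (N :: s); split=> /=.
- by rewrite s_uniq andbT; apply/negP => /s_lt; rewrite ltnn.
- by move=> t; rewrite inE => /orP[/eqP-> | /s_lt /ltnW].
- by rewrite s_size.
- by rewrite s_sum; clear -le_Nv; lia.
Qed.

Lemma sumn_shift (d : nat) (s : seq nat) : sumn [seq (d + t)%N | t <- s] = (d * size s + sumn s)%N.
Proof. by elim: s => [|t s IH] /=; rewrite ?muln0 // IH; lia. Qed.

Lemma uniq_shift (d : nat) (s : seq nat) : uniq [seq (d + t)%N | t <- s] = uniq s.
Proof. by apply: map_inj_uniq; apply: addnI. Qed.

Lemma critical_set_sizes (m k : nat) :
  (0 < m)%N -> (m ^ 2 <= k)%N -> (k + 4 * m <= 3 * m ^ 2 + 2)%N -> has_critical_set m k.
Proof.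
case: m => // r _ lo hi; have odd_sq : odd (r.+1 ^ 2) = odd r.+1 by rewrite oddX.
have shift_lt d N T : {in T, forall t, t < N}%N ->
    {in [seq (d + t)%N | t <- T], forall t, t < d + N}%N.
  by move=> T_lt _ /mapP[t /T_lt t_lt ->]; rewrite ltn_add2l.
have shift_ge d x T : (x < d)%N -> x \notin [seq (d + t)%N | t <- T].
  by move=> x_lt; apply/mapP => -[t _ x_dt]; move: x_lt; rewrite x_dt ltnNge leq_addr.
case par: (odd (k + r.+1)); last first.
  (* Here [s] consists of 0 and [r] offsets shifted by 1, of sum [r + v], so that the size is
     [r + 1 + 2 * (r + v)]. The extreme values of [v] give exactly the two ends of the range for
     [k]. *)
  have [v v_def] : exists v, (k = 3 * r + 1 + 2 * v)%N.
    exists (k - (3 * r + 1))./2; have : (3 * r + 1 <= k)%N by nia.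
    by move: par; clear; lia.
  have [|||T [T_uniq T_lt T_size T_sum]] := @subset_sum (2 * r) r v;
    [clear; lia | move: (double_bin2 r) v_def lo; clear; nia
    | rewrite binS bin1; move: (double_bin2 r) v_def hi; clear; nia |].
  have -> : k = (r.+1 + 2 * sumn (0%N :: [seq (1 + t)%N | t <- T]))%N.
    by rewrite /= sumn_shift T_size T_sum v_def; lia.
  apply: circulant_critical => //=.
  - by rewrite uniq_shift T_uniq shift_ge.
  - by rewrite size_map T_size.
  - by move=> t; rewrite inE => /orP[/eqP-> | /(shift_lt _ _ _ T_lt)]; lia.
case: r => [|r] in lo hi odd_sq par *; first by move: par; have -> : k = 1%N by lia.
(* The same formula serves both modifications: [s] is 0 with [r + 1] offsets shifted by 2 and the
   size lowered by one, or 0, 1 with [r] such offsets and the size raised by one. *)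
have [v v_def] : exists v, (k = 5 * r + 5 + 2 * v)%N.
  exists (k - (5 * r + 5))./2; have : (5 * r + 5 <= k)%N by nia.
  by move: par; clear; lia.
(* The threshold is twice the least sum of [r + 1] distinct naturals. Above it the variant without
   offset 1 applies, and below it the variant with offset 1. *)
have [le_k | gt_k] := leqP (r * r.+1) (2 * v).
  (* Both ends of the range have the parity of [m], so a [k] of the other parity misses them by at
     least one. This makes up for the unit gained or lost. *)
  have hi' : (k + 4 * r.+2 <= 3 * r.+2 ^ 2 + 1)%N by move: (r.+2 ^ 2)%N odd_sq hi => q; lia.
  have [|||T [T_uniq T_lt T_size T_sum]] := @subset_sum (2 * r + 1) r.+1 v;
    [clear; lia | move: (double_bin2 r.+1) le_k; clear; nia
    | rewrite binS bin1; move: (double_bin2 r.+1) v_def hi'; clear; nia |].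
  have -> : k = (r.+2 + 2 * sumn (0%N :: [seq (2 + t)%N | t <- T])).-1%N.
    by rewrite /= sumn_shift T_size T_sum v_def; lia.
  apply: circulant_critical_pred => //=.
  - by rewrite uniq_shift T_uniq shift_ge.
  - by rewrite size_map T_size.
  - by move=> t; rewrite inE => /orP[/eqP-> | /(shift_lt _ _ _ T_lt)]; lia.
  - by rewrite inE /= shift_ge.
have lo' : (r.+2 ^ 2 < k)%N by move: (r.+2 ^ 2)%N odd_sq lo => q; lia.
have [|||T [T_uniq T_lt T_size T_sum]] := @subset_sum (2 * r + 1) r v;
  [clear; lia | move: (double_bin2 r) v_def lo'; clear; nia
  | rewrite binS bin1; move: (double_bin2 r) gt_k; clear; nia |].
have -> : k = (r.+2 + 2 * sumn (0 :: 1 :: [seq (2 + t)%N | t <- T])%N).+1%N.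
  by rewrite /= sumn_shift T_size T_sum v_def; lia.
apply: circulant_critical_succ => //=.
- by rewrite inE negb_or uniq_shift T_uniq !shift_ge.
- by rewrite size_map T_size.
- by move=> t; rewrite !inE => /or3P[/eqP-> | /eqP-> | /(shift_lt _ _ _ T_lt)]; lia.
Qed.

Theorem theorem17 (m : nat) (hm : (1 <= m)%N) (k : int)
    (hk : m%:Z ^+ 2 <= k <= 3 * m%:Z ^+ 2 - 4 * m%:Z + 2) :
  exists M : 'M[bool]_(2 * m)%N,
    M \in Lambda (2 * m)%N m /\
    exists D : {set 'I_(2 * m)%N * 'I_(2 * m)%N * bool},
      critical_set M D /\ #|D|%:Z = k.
Proof.
move: hk; rewrite expr2; case: k => k /andP[lo hi]; last by nia.
have [||M [ML [D [crit card_D]]]] := @critical_set_sizes m k hm.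
- by rewrite -mulnn; lia.
- by rewrite -mulnn; lia.
by exists M; split=> //; exists D; rewrite card_D.
Qed.
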